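(* Let $K$ be a number field of degree $t+2s$ with signature $(t,s)$, $s\ge1$, let $\sigma_1,\dots,\sigma_t$ be its real embeddings and $\sigma_{t+1},\dots,\sigma_{t+s}$ a set of complex embeddings, one from each pair of complex conjugate embeddings; write $\alpha^{(i)}=\sigma_i(\alpha)$, and identify $K$ with $\sigma_{t+1}(K)\subset\mathbb{C}$ (so $\alpha=\alpha^{(t+1)}$). Let $\mathfrak{o}$ be an order of $K$ and let $\epsilon\in\mathfrak{o}$ be a complex Pisot number, i.e. $|\epsilon|>1$ and $|\epsilon^{(i)}|<1$ for all $i\in\{1,\dots,t+s\}$, $i\ne t+1$. Let $\Sigma\subset\mathfrak{o}$ be a finite set, and put $C_i=\max\{|c^{(i)}|: c\in\Sigma\}$ for $i\in\{1,\dots,t+s\}$, $i\neq t+1$. Let $P\subset\mathbb{C}$ be a compact set containing a neighborhood of $0$, and let $$\mathcal{B}(\epsilon,\Sigma,P)=\Big\{\alpha\in\mathfrak{o}: \alpha\in P \text{ and } |\alpha^{(i)}|\le \frac{C_i}{1-|\epsilon^{(i)}|}\text{ for all } i\in\{1,\dots,t+s\},\ i\neq t+1\Big\},$$ which is a finite set. Assume that $$\epsilon P\subset\bigcup_{s\in\Sigma}(s+P).$$ Then for each $\alpha\in\mathfrak{o}$ there exist $N,n\in\mathbb{N}$, elements $c_0,\dots,c_n\in\Sigma$ and $\beta\in\mathcal{B}(\epsilon,\Sigma,P)$ such that $$\alpha\epsilon^N=\beta+\sum_{i=0}^n c_i\epsilon^i.$$ *)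

(* Defs.v *)
(* Complex numbers are R[i] for an arbitrary realType R; R[i]^o carries the
   topology of the complex modulus. *)
From HB Require Export structures.
From mathcomp Require Export all_boot all_order all_algebra all_field finmap.
From mathcomp Require Export all_classical all_reals all_analysis.
From mathcomp Require Export complex.
Export Order.TTheory GRing.Theory Num.Theory numFieldNormedType.Exports.

Set Implicit Arguments.
Unset Strict Implicit.
Unset Printing Implicit Defensive.

Local Open Scope classical_set_scope.
Local Open Scope ring_scope.

Definition real_embedding (R : realType) (K : fieldExtType rat)
    (tau : {rmorphism K -> R[i]}) : Prop :=
  forall x, tau x \is Num.real.

(* The first t entries of sigma list each real embedding exactly once; the last
   s entries contain exactly one member of each pair of complex conjugate
   embeddings. *)
Definition signature_embeddings (R : realType) (K : fieldExtType rat)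
    (t s : nat) (sigma : 'I_(t + s) -> {rmorphism K -> R[i]}) : Prop :=
  [/\ forall i : 'I_t, real_embedding (sigma (lshift s i)),
      forall j : 'I_s, ~ real_embedding (sigma (rshift t j)),
      forall tau : {rmorphism K -> R[i]}, real_embedding tau ->
        exists! i : 'I_t, tau =1 sigma (lshift s i)
    & forall tau : {rmorphism K -> R[i]}, ~ real_embedding tau ->
        exists! j : 'I_s, tau =1 sigma (rshift t j) \/
          (forall x, tau x = (sigma (rshift t j) x)^*)].

(* An order is a subring that is a free Z-module on a Q-basis of K. *)
Definition is_order (K : fieldExtType rat) (o : {pred K}) : Prop :=
  subring_closed o /\
  exists b : (\dim {:K}).-tuple K,
    basis_of {:K} b /\ forall x, x \in o <-> inIntSpan b x.

(* With indices starting at 0, the embedding sigma_{t+1} has index t. *)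
Definition idx0 (t s : nat) (s_gt0 : (0 < s)%N) : 'I_(t + s) :=
  rshift t (Ordinal s_gt0).

Definition complex_pisot (R : realType) (K : fieldExtType rat) (n : nat)
    (sigma : 'I_n -> {rmorphism K -> R[i]}) (i0 : 'I_n) (eps : K) : Prop :=
  1 < Normc.normc (sigma i0 eps) /\
  forall i, i != i0 -> Normc.normc (sigma i eps) < 1.

(* The default value 0 only matters for empty Sigma. *)
Definition maxabs (R : realType) (K : fieldExtType rat)
    (tau : {rmorphism K -> R[i]}) (Sigma : {fset K}) : R :=
  \big[Num.max/0]_(c <- Sigma) Normc.normc (tau c).

Definition calB (R : realType) (K : fieldExtType rat) (n : nat)
    (sigma : 'I_n -> {rmorphism K -> R[i]}) (i0 : 'I_n) (o : {pred K})
    (eps : K) (Sigma : {fset K}) (P : set R[i]^o) : set K :=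
  [set a | [/\ a \in o, P (sigma i0 a)
    & forall i, i != i0 ->
        Normc.normc (sigma i a) <=
        maxabs (sigma i) Sigma / (1 - Normc.normc (sigma i eps))]].

(* Main.v *)
Require Import Defs.

(** Write [e = sigma_{t+1} eps].  As [|e| > 1] and [P] is a neighbourhood of
    [0], some [alpha / e ^ k] lies in [P]; iterating the covering hypothesis
    [m = k + N] times from there yields digits in [Sigma] such that
    [beta_N = alpha * eps ^ N - \sum_(j < m) c_j * eps ^ j] lies in the order
    and in [P].  At the other embeddings the geometric series gives
    [|beta_N| <= |alpha| |eps| ^ N + C / (1 - |eps|)].  All [beta_N] hence lie in
    one finite set, and a finite set has a gap above each [C / (1 - |eps|)]:
    for large [N] the vanishing error term can be dropped.

    Finiteness of the elements of an order with bounded conjugates: the [t + 2s]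
    embeddings are pairwise distinct, so by Artin's independence of characters
    the matrix of conjugates of a basis is invertible, and the integer
    coordinates are bounded in terms of the conjugates. *)

Set Implicit Arguments.
Unset Strict Implicit.
Unset Printing Implicit Defensive.

Local Open Scope classical_set_scope.
Local Open Scope ring_scope.

(** * The modulus on [R[i]] as an [R]-valued function *)

Section ComplexModulus.
Variable R : rcfType.
Implicit Types x y : R[i].
Local Notation normc := (@Normc.normc R).

Lemma normcE_norm x : `|x| = (normc x)%:C%C.
Proof. by []. Qed.

Lemma normc_ge0 x : 0 <= normc x.
Proof. by rewrite -lecR -normcE_norm normr_ge0. Qed.

Lemma normcX x n : normc (x ^+ n) = normc x ^+ n.
Proof.
elim: n => [|n IHn]; first by rewrite !expr0 Normc.normc1.
by rewrite !exprS Normc.normcM IHn.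
Qed.

Lemma ler_normcB x y : normc (x - y) <= normc x + normc y.
Proof. by rewrite -lecR rmorphD -!normcE_norm ler_normB. Qed.

Lemma ler_normc_sum (I : finType) (F : I -> R[i]) :
  normc (\sum_i F i) <= \sum_i normc (F i).
Proof. by rewrite -lecR rmorph_sum -normcE_norm ler_norm_sum. Qed.

Lemma ler_dist_normc x y : `|normc x - normc y| <= normc (x - y).
Proof.
have normJ (r : R) : `|r|%:C%C = `|r%:C%C|.
  by rewrite normc_def /= expr0n /= addr0 sqrtr_sqr.
by rewrite -lecR normJ rmorphB; apply: (ler_dist_dist x y).
Qed.

Lemma normc_conj x : normc (x^*) = normc x.
Proof. by apply: (@complexI R); rewrite -!normcE_norm norm_conjC. Qed.

Lemma normc_intr (z : int) : normc z%:~R = `|z%:~R|.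
Proof.
apply: (@complexI R); rewrite -normcE_norm -!intr_norm.
by rewrite [RHS](rmorph_int (real_complex R)).
Qed.

End ComplexModulus.

Lemma normc_continuous (R : realType) :
  continuous (fun x : R[i]^o => Normc.normc x : R^o).
Proof.
move=> x; apply/(@cvgrPdist_lt _ _ _ _ (nbhs_filter x)) => e e_gt0.
apply/nbhs_ballP; exists e%:C%C; rewrite /= ?ltcR// => y xy.
rewrite -ltcR; apply: le_lt_trans xy.
by rewrite lecR ler_dist_normc.
Qed.

Lemma compact_normc_bounded (R : realType) (P : set R[i]^o) :
  compact P -> exists B : R, forall x, P x -> Normc.normc x <= B.
Proof.
move=> cP.
have cN : compact ((fun x : R[i]^o => Normc.normc x : R^o) @` P).
  apply: continuous_compact cP; apply: continuous_subspaceT.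
  exact: normc_continuous.
have [M [_ /(_ (M + 1))]] := compact_bounded cN; rewrite ltrDl ltr01.
move=> /(_ isT) bM; exists (M + 1) => x Px.
by apply: le_trans (ler_norm _) (bM _ _); exists x.
Qed.

(** * Independence of embeddings, and finiteness from bounded conjugates *)

(** Induction on [m]: subtracting [tau ord0 y] times the relation at [x] from the relation at
    [x * y] removes the term of index 0. The shorter relation has coefficients
    [a j * (tau j y - tau ord0 y)], and for each [j] other than [ord0] some [y] makes the second
    factor nonzero. *)
Lemma artin_independence (F L : fieldType) (m : nat)
    (tau : 'I_m -> {rmorphism F -> L}) :
  (forall i j, tau i =1 tau j -> i = j) ->
  forall a : 'I_m -> L, (forall x, \sum_i a i * tau i x = 0) ->
  forall i, a i = 0.
Proof.
elim: m tau => [|m IHm] tau tau_inj a a0; first by case.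
have aS (i : 'I_m) : a (lift ord0 i) = 0.
  have eqa y : a (lift ord0 i) * (tau (lift ord0 i) y - tau ord0 y) = 0.
    apply: (IHm (fun i => tau (lift ord0 i)) _
      (fun i => a (lift ord0 i) * (tau (lift ord0 i) y - tau ord0 y))).
      by move=> j k /tau_inj /lift_inj.
    move=> x.
    transitivity (\sum_j a j * (tau j y - tau ord0 y) * tau j x).
      by rewrite [RHS]big_ord_recl subrr mulr0 mul0r add0r.
    transitivity (\sum_j a j * tau j (x * y) -
        (\sum_j a j * tau j x) * tau ord0 y); last by rewrite !a0 mul0r subrr.
    rewrite mulr_suml -sumrB; apply: eq_bigr => j _.
    by rewrite mulrBr mulrBl mulrC rmorphM mulrCA (mulrAC _ (tau ord0 y)).
  apply: contrapT => /eqP ai0.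
  have /tau_inj// : tau ord0 =1 tau (lift ord0 i).
  move=> y; have /eqP := eqa y.
  by rewrite mulf_eq0 (negPf ai0) subr_eq0 => /eqP.
move=> i; have [j ->|->] := unliftP ord0 i; first exact: aS.
have := a0 1; rewrite big_ord_recl rmorph1 mulr1 big1 ?addr0// => j _.
by rewrite aS mul0r.
Qed.

(** A vector of the left kernel is a linear relation between the [tau i] on the basis. It extends to
    all of [K] because embeddings fix the rationals, so Artin's lemma applies. *)
Lemma conjugate_matrix_row_free (K : fieldExtType rat) (L : fieldType)
    (m n : nat) (tau : 'I_m -> {rmorphism K -> L}) (b : n.-tuple K) :
  (forall i j, tau i =1 tau j -> i = j) -> basis_of {:K} b ->
  row_free (\matrix_(i < m, k < n) tau i b`_k).
Proof.
move=> tau_inj bP; apply: inj_row_free => v v0; apply/rowP => i.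
rewrite mxE; apply: (@artin_independence _ _ _ tau tau_inj (v ord0)) => x.
rewrite (coord_basis bP (memvf x)).
under eq_bigr do rewrite rmorph_sum mulr_sumr.
rewrite exchange_big big1// => k _.
have /rowP/(_ k) := v0; rewrite !mxE => vk.
under eq_bigr do rewrite rmorphZ_num mulrCA.
rewrite -mulr_sumr -[RHS](mulr0 (ratr (coord b k x))) -[in RHS]vk.
by congr (_ * _); apply: eq_bigr => j _; rewrite mxE.
Qed.

Lemma finite_bounded_int_span (V : zmodType) (n D : nat) (b : n.-tuple V) :
  finite_set [set x : V | exists a : int ^ n,
    x = \sum_(i < n) b`_i *~ a i /\ forall i, (`|a i| <= D)%N].
Proof.
pose f (g : {ffun 'I_n -> 'I_D.+1 * bool}) : V :=
  \sum_(i < n) b`_i *~ ((-1) ^+ (g i).2 * (g i).1%:Z).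
apply: sub_finite_set (finite_image f (@finite_finset _ setT)).
move=> x [a [-> aD]]; exists [ffun i => (inord `|a i|%N, a i < 0)] => //.
apply: eq_bigr => i _; rewrite ffunE /= inordK ?ltnS ?aD//.
by rewrite -intEsign.
Qed.

(** A left inverse [W] of the matrix of conjugates recovers the integer coordinates of [x] from its
    conjugates. *)
Lemma finite_bounded_conjugates (R : realType) (K : fieldExtType rat)
    (n : nat) (tau : 'I_n -> {rmorphism K -> R[i]}) (m : nat) (b : m.-tuple K)
    (B : R) :
  (forall i j, tau i =1 tau j -> i = j) -> basis_of {:K} b -> m = n ->
  finite_set [set x | inIntSpan b x /\
                      forall i, Normc.normc (tau i x) <= B].
Proof.
move=> tau_inj bP mn.
pose M := \matrix_(i < n, k < m) tau i b`_k.
have /row_fullP[W WM] : row_full M.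
  by rewrite /row_full (eqP (conjugate_matrix_row_free tau_inj bP)) mn.
(* One bound for all coordinates: it dominates each row sum, the others being nonnegative. [B] may
   be negative, hence the absolute value. *)
pose S := \sum_k \sum_i Normc.normc (W k i) * `|B|.
have rows_ge0 k : 0 <= \sum_i Normc.normc (W k i) * `|B|.
  by apply: sumr_ge0 => i _; rewrite mulr_ge0 ?normc_ge0.
have S_ge0 : 0 <= S by apply: sumr_ge0.
apply: sub_finite_set (finite_bounded_int_span (Num.bound S) b).
move=> x [[a ax] xB]; exists a; split=> // k.
have Wx : (a k)%:~R = \sum_i W k i * tau i x.
  transitivity ((W *m M *m (\col_l (a l)%:~R)) k ord0).
    by rewrite WM mul1mx mxE.
  rewrite -mulmxA mxE; apply: eq_bigr => i _; congr (_ * _).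
  rewrite mxE ax rmorph_sum; apply: eq_bigr => l _.
  by rewrite !mxE rmorphMz mulrzr.
rewrite -(ler_nat R) natr_absz intr_norm -normc_intr Wx.
apply: le_trans (ltW (archi_boundP S_ge0)); apply: le_trans (ler_normc_sum _) _.
apply: (@le_trans _ _ (\sum_i Normc.normc (W k i) * `|B|)).
  apply: ler_sum => i _; rewrite Normc.normcM ler_wpM2l ?normc_ge0//.
  exact: le_trans (xB i) (ler_norm _).
by rewrite /S (bigD1 k) //= lerDl sumr_ge0.
Qed.

(** * The full list of embeddings, and finiteness in an order *)

Section Embeddings.
Variables (R : realType) (K : fieldExtType rat) (t s : nat).
Variable sigma : 'I_(t + s) -> {rmorphism K -> R[i]}.

(** Adding the conjugates of the nonreal embeddings gives [t + 2 * s] of them, which makes the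
    matrix of conjugates square. *)
Definition full_embeddings (k : 'I_(t + s + s)) : {rmorphism K -> R[i]} :=
  match fintype.split k with
  | inl i => sigma i
  | inr j => (@Num.conj R[i] \o sigma (rshift t j) : {rmorphism K -> R[i]})
  end.

Hypothesis sigmaP : signature_embeddings sigma.

Lemma signature_embeddings_inj i j : sigma i =1 sigma j -> i = j.
Proof.
case: sigmaP => sR sC uR uC.
case: (split_ordP i) => i' ->; case: (split_ordP j) => j' -> eq_ij.
- have [k [_ uk]] := uR _ (sR i').
  by rewrite -(uk j' eq_ij) -(uk i' (fun=> erefl)).
- by case: (sC j') => x; rewrite -eq_ij; apply: sR.
- by case: (sC i') => x; rewrite eq_ij; apply: sR.
- have [k [_ uk]] := uC _ (sC i').
  by rewrite -(uk j' (or_introl eq_ij)) -(uk i' (or_introl (fun=> erefl))).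
Qed.

(** If [sigma i] is real, [sigma (rshift t j)] would be real too. Otherwise uniqueness of the
    representative of a conjugate pair forces [i = rshift t j], and an embedding equal to its own
    conjugate is real. *)
Lemma signature_embeddings_conj i (j : 'I_s) :
  ~ (forall x, sigma i x = (sigma (rshift t j) x)^*).
Proof.
case: sigmaP => sR sC uR uC.
case: (split_ordP i) => i' -> eq_ij.
  by case: (sC j) => x; rewrite -CrealJ -eq_ij; apply: sR.
have [k [_ uk]] := uC _ (sC i').
have ij : i' = j.
  by rewrite -(uk j (or_intror eq_ij)) -(uk i' (or_introl (fun=> erefl))).
by case: (sC j) => x; apply/CrealP; rewrite -eq_ij ij.
Qed.

Lemma full_embeddings_inj k l : full_embeddings k =1 full_embeddings l -> k = l.
Proof.
rewrite /full_embeddings; case: (split_ordP k) => i ->;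
  case: (split_ordP l) => j -> eq_ij.
- by rewrite (signature_embeddings_inj eq_ij).
- by case: (signature_embeddings_conj eq_ij).
- by case: (@signature_embeddings_conj j i) => x; rewrite -eq_ij.
- congr (rshift _ _); apply: (@rshift_inj t).
  apply: signature_embeddings_inj => x; exact: (can_inj conjCK (eq_ij x)).
Qed.

Lemma finite_bounded_order (o : {pred K}) (B : 'I_(t + s) -> R) :
  \dim {:K} = (t + 2 * s)%N -> is_order o ->
  finite_set [set x | x \in o /\ forall i, Normc.normc (sigma i x) <= B i].
Proof.
move=> degK [_ [b [bP ob]]].
have dE : \dim {:K} = (t + s + s)%N by rewrite degK mul2n -addnn addnA.
pose C := \big[Num.max/0]_i B i.
apply: sub_finite_set (finite_bounded_conjugates C full_embeddings_inj bP dE).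
move=> x [/ob xb xB]; split=> // k.
have xC i : Normc.normc (sigma i x) <= C.
  exact: le_trans (xB i) (le_bigmax _ _ _).
by rewrite /full_embeddings; case: fintype.split => i //=; rewrite normc_conj.
Qed.

End Embeddings.

(** * Expansions in powers of [eps] and their estimates *)

Lemma exists_beta_expansion (F L : fieldType) (tau : {rmorphism F -> L})
    (eps : F) (Sigma : {fset F}) (P : set L) :
  [set tau eps * p | p in P] `<=`
    \bigcup_(c in [set` Sigma]) [set tau c + p | p in P] ->
  forall (m : nat) x, P x -> exists2 c : nat -> F,
    (forall j, (j < m)%N -> c j \in Sigma) &
    P (tau eps ^+ m * x - tau (\sum_(j < m) c j * eps ^+ j)).
Proof.
move=> cover; elim=> [|m IHm] x Px.
  by exists (fun=> 0) => //; rewrite big_ord0 rmorph0 subr0 mul1r.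
have [c cS /= Py] := IHm x Px.
have [d dS [p Pp dp]] := cover _ (ex_intro2 _ _ _ Py erefl).
(* Multiplication by [eps] raises the exponents of the old digits by one, so the new digit [d]
   enters at exponent 0. *)
exists (fun j => if j is j'.+1 then c j' else d) => [[|j]|//]; first by [].
  exact: cS.
rewrite [X in P X](_ : _ = p)// big_ord_recl expr0 mulr1 rmorphD opprD addrA.
have -> : \sum_(j < m) c j * eps ^+ (lift ord0 j) =
    eps * \sum_(j < m) c j * eps ^+ j.
  by rewrite mulr_sumr; apply: eq_bigr => j _; rewrite exprS mulrCA.
by rewrite rmorphM exprS -mulrA addrAC -mulrBr -dp addrAC subrr add0r.
Qed.

(** If [b < x], then [a * r ^ N] eventually drops below the gap [x - b] and the premise fails. *)
Lemma eventually_le_gap (R : realType) (a b x r : R) : 0 <= r < 1 ->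
  \forall N \near \oo, x <= a * r ^+ N + b -> x <= b.
Proof.
move=> /andP[r_ge0 r_lt1]; have [xb|bx] := leP x b; first by near=> N.
have /cvgr_lt/(_ (x - b)) : geometric a r x @[x --> \oo] --> (0 : R).
  by apply: cvg_geometric; rewrite ger0_norm.
rewrite subr_gt0 => /(_ bx); apply: filterS => N /=.
by rewrite ltrBrDr => h /(le_lt_trans) /(_ h); rewrite ltxx.
Unshelve. all: by end_near. Qed.

Lemma ler_geometric_sum (R : realFieldType) (r : R) (m : nat) : 0 <= r < 1 ->
  \sum_(j < m) r ^+ j <= (1 - r)^-1.
Proof.
move=> /andP[r_ge0 r_lt1]; have r1 : 0 < 1 - r by rewrite subr_gt0.
rewrite -[leRHS]mul1r ler_pdivlMr// mulrC -opprB mulNr -subrX1 opprB.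
by rewrite gerBl exprn_ge0.
Qed.

Lemma nbhs0_divX (R : realType) (P : set R[i]^o) (e x : R[i]) :
  nbhs (0 : R[i]^o) P -> 1 < Normc.normc e -> exists k, P (x / e ^+ k).
Proof.
move=> /nbhs_ballP[d /= d_gt0 dP] e_gt1.
have nd_gt0 : 0 < Normc.normc d by rewrite -ltcR -normcE_norm normr_gt0 gt_eqF.
have [e_ge0 ie_lt1] : 0 <= (Normc.normc e)^-1 /\ (Normc.normc e)^-1 < 1.
  by rewrite invr_ge0 normc_ge0 invf_lt1// (lt_trans _ e_gt1).
have /cvgr_lt/(_ _ nd_gt0) :
    geometric (Normc.normc x) (Normc.normc e)^-1 k @[k --> \oo] --> (0 : R).
  by apply: cvg_geometric; rewrite ger0_norm.
move=> [k _ /(_ k (leqnn k)) /= xk]; exists k; apply: dP.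
(* The radius [d] is a positive element of [R[i]], hence equal to its modulus, which moves the
   comparison to [R]. *)
rewrite -ball_normE /= sub0r normrN -(gtr0_norm d_gt0) !normcE_norm ltcR.
by rewrite Normc.normcM Normc.normcV normcX -exprVn.
Qed.

Section SubringClosed.
Variables (A : nzRingType) (o : {pred A}) (x : A).
Hypotheses (oS : GRing.subring_closed o) (x_o : x \in o).

Lemma subring_closedX n : x ^+ n \in o.
Proof.
have [ one_o _ oM] := oS.
by elim: n => [|n IHn]; rewrite ?expr0// exprS oM.
Qed.

Lemma subring_closed_horner (c : nat -> A) m :
  (forall j, (j < m)%N -> c j \in o) -> \sum_(j < m) c j * x ^+ j \in o.
Proof.
have [zero_o oD] := GRing.zmod_closedD (GRing.subring_closedB oS).
have [_ _ oM] := oS => co; apply: (big_ind (fun y => y \in o)) => // j _.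
by rewrite oM ?co ?subring_closedX.
Qed.

End SubringClosed.

(** The digits contribute at most a geometric series, whatever their number [m]. *)
Lemma ler_normc_beta (R : realType) (K : fieldExtType rat)
    (tau : {rmorphism K -> R[i]}) (Sigma : {fset K}) (eps alpha : K)
    (c : nat -> K) (N m : nat) :
  Normc.normc (tau eps) < 1 -> (forall j, (j < m)%N -> c j \in Sigma) ->
  Normc.normc (tau (alpha * eps ^+ N - \sum_(j < m) c j * eps ^+ j)) <=
  Normc.normc (tau alpha) * Normc.normc (tau eps) ^+ N +
  maxabs tau Sigma / (1 - Normc.normc (tau eps)).
Proof.
move=> eps_lt1 cS; rewrite rmorphB rmorphM rmorphXn.
apply: le_trans (ler_normcB _ _) _; rewrite Normc.normcM normcX lerD2l.
(* The maximum starts from 0, so this holds for empty [Sigma] as well. *)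
have max_ge0 : 0 <= maxabs tau Sigma.
  by apply: (big_ind (fun x => 0 <= x)) => // [x y x0 y0|i _];
    rewrite ?normc_ge0// le_max x0.
apply: (@le_trans _ _
    (\sum_(j < m) maxabs tau Sigma * Normc.normc (tau eps) ^+ j)).
  rewrite rmorph_sum; apply: le_trans (ler_normc_sum _) _.
  apply: ler_sum => j _; rewrite rmorphM rmorphXn Normc.normcM normcX.
  rewrite ler_wpM2r ?exprn_ge0 ?normc_ge0// /maxabs.
  exact: (le_bigmax_seq _ (c j) _ _ (cS _ (ltn_ord j))).
by rewrite -mulr_sumr ler_wpM2l// ler_geometric_sum// normc_ge0 eps_lt1.
Qed.

Theorem theorem3p1 (R : realType) (K : fieldExtType rat) (t s : nat)
    (s_gt0 : (0 < s)%N)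
    (degK : \dim {:K} = (t + 2 * s)%N)
    (sigma : 'I_(t + s) -> {rmorphism K -> R[i]})
    (sigmaP : signature_embeddings sigma)
    (o : {pred K}) (oP : is_order o)
    (eps : K) (eps_o : eps \in o)
    (eps_pisot : complex_pisot sigma (idx0 t s_gt0) eps)
    (Sigma : {fset K}) (Sigma_o : {subset Sigma <= o})
    (P : set R[i]^o) (P_compact : compact P) (P_nbhs0 : nbhs (0 : R[i]^o) P)
    (P_cover : [set sigma (idx0 t s_gt0) eps * p | p in P] `<=`
       \bigcup_(c in [set` Sigma])
         [set sigma (idx0 t s_gt0) c + p | p in P]) :
  finite_set (calB sigma (idx0 t s_gt0) o eps Sigma P) /\
  forall alpha : K, alpha \in o ->
    exists (N n : nat) (c : 'I_n.+1 -> K) (beta : K),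
      [/\ forall i, c i \in Sigma,
          calB sigma (idx0 t s_gt0) o eps Sigma P beta
        & alpha * eps ^+ N = beta + \sum_(i < n.+1) c i * eps ^+ i].
Proof.
set i0 := idx0 t s_gt0 in eps_pisot P_cover *; clearbody i0.
case: eps_pisot => eps_gt1 eps_lt1.
have [B PB] := compact_normc_bounded P_compact.
pose b i := maxabs (sigma i) Sigma / (1 - Normc.normc (sigma i eps)).
have finB (C : 'I_(t + s) -> R) : finite_set [set a | [/\ a \in o,
    P (sigma i0 a) & forall i, i != i0 -> Normc.normc (sigma i a) <= C i]].
  pose C' i := if i == i0 then B else C i.
  apply: sub_finite_set (finite_bounded_order sigmaP C' degK oP).
  move=> a [ao aP aC]; split=> // i; rewrite /C'.
  by case: eqVneq => [->|/aC//]; apply: PB.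
split; first exact: finB.
move=> alpha alpha_o.
(* Away from [i0] the powers of [eps] have modulus at most 1, so [b'] bounds the conjugates of
   [beta] for every [N], and [X] can be fixed before [N]. *)
pose b' i := Normc.normc (sigma i alpha) + b i.
have [X XE] := (finite_fsetP.1 (finB b')).
(* Each pair of an [x] in [X] and an index [i] has its own threshold; there are finitely many pairs,
   so one [N] serves them all. *)
have gap : \forall N \near \oo, forall (x : X) i, i != i0 ->
    Normc.normc (sigma i (val x)) <=
      Normc.normc (sigma i alpha) * Normc.normc (sigma i eps) ^+ N + b i ->
    Normc.normc (sigma i (val x)) <= b i.
  apply: filter_forall => x; apply: filter_forall => i.
  have [->|ii0] := eqVneq i i0; first by near=> N.
  have := @eventually_le_gap _ (Normc.normc (sigma i alpha)) (b i)
    (Normc.normc (sigma i (val x))) (Normc.normc (sigma i eps)).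
  rewrite normc_ge0 eps_lt1// => /(_ isT).
  by apply: filterS => N gapN _; apply: gapN.
(* The exponent is taken as a successor so that the number of digits, [k + N0.+1], has the form
   [n.+1] with [n = k + N0]. *)
have [N0 _ /(_ N0.+1 (leqnSn N0)) {}gap] := gap.
have [k Pk] := nbhs0_divX (sigma i0 alpha) P_nbhs0 eps_gt1.
have eps0 : sigma i0 eps != 0.
  by apply: contraTneq eps_gt1 => ->; rewrite Normc.normc0 -leNgt ler01.
have [c cS] := exists_beta_expansion P_cover (k + N0.+1) Pk.
set sm := \sum_(j < _) _; pose beta := alpha * eps ^+ N0.+1 - sm.
(* The first [k] multiplications by [eps] undo the division that brought [alpha] into [P]. *)
have -> : sigma i0 eps ^+ (k + N0.+1) * (sigma i0 alpha / sigma i0 eps ^+ k) -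
    sigma i0 sm = sigma i0 beta.
  rewrite /beta rmorphB rmorphM rmorphXn; congr (_ - _).
  by rewrite exprD mulrC mulrA divfK ?expf_neq0.
move=> betaP.
have oS : GRing.subring_closed o by case: oP.
have beta_o : beta \in o.
  have [_ oB oM] := oS; rewrite oB ?oM ?subring_closedX//.
  by apply: subring_closed_horner => // j /cS /Sigma_o.
have beta_le i : i != i0 -> Normc.normc (sigma i beta) <=
    Normc.normc (sigma i alpha) * Normc.normc (sigma i eps) ^+ N0.+1 + b i.
  by move=> /eps_lt1 ei; apply: ler_normc_beta.
have betaX : beta \in X.
  suff : [set` X] beta by [].
  rewrite -XE; split=> // i ii0; apply: le_trans (beta_le i ii0) _.
  rewrite lerD2r ler_piMr ?normc_ge0// exprn_ile1 ?normc_ge0//.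
  exact/ltW/eps_lt1.
exists N0.+1, (k + N0)%N, (fun j => c j), beta; split.
- by move=> j; apply: cS; rewrite addnS.
- split=> // i ii0; exact: (gap [` betaX]%fset i ii0 (beta_le i ii0)).
- by rewrite /beta /sm addnS subrK.
Unshelve. all: by end_near. Qed.
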